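(* For every $K\in\mathbb{N}$ there exists $N(K)\in\mathbb{N}$ such that for every finite $K$-approximate subring $X$ of a ring, putting $Y:=4X+X\cdot 4X$, either there is an $N(K)$-thick subset of $Y$ (in particular, one of cardinality at least $\frac{|Y|}{N(K)-1}$) consisting of zero divisors, or $Y$ is a subring (additively $K^{11}$-commensurable with $X$).
   Context: Rings are associative but not necessarily commutative or unital. For subsets $Y,Z$ of a ring, $Y+Z=\{y+z\}$, $Y\cdot Z=\{yz\}$ ($y\in Y,z\in Z$), and $nZ$ is the set of sums of $n$ elements of $Z$. A subset $X$ of a ring is a $K$-approximate subring if it is additively symmetric ($0\in X$, $X=-X$) and $(X\cdot X)\cup(X+X)$ is covered by $K$ additive translates of $X$. A subset $D\subseteq Y$ of an additively symmetric set $Y$ is an $N$-thick subset of $Y$ ($N$ a positive integer) if $D$ is additively symmetric and for all $r_0,\dots,r_{N-1}\in Y$ there are $i<j<N$ with $r_i-r_j\in D$. A zero divisor is an element $d$ of the ring such that $dx=0$ or $xd=0$ for some nonzero $x$ in the ring (in particular $0$ counts as a zero divisor in a nonzero ring). Two sets are additively $N$-commensurable if each is covered by $N$ additive translates of the other. *)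

(* Defs.v *)
From HB Require Import structures.
From mathcomp Require Import all_boot all_order all_algebra.
From mathcomp Require Import finmap.

Set Implicit Arguments.
Unset Strict Implicit.
Unset Printing Implicit Defensive.

Import Order.TTheory GRing.Theory Num.Theory.

Local Open Scope fset_scope.
Local Open Scope ring_scope.

(* Associative rings without a unit and without commutativity; the weakest    *)
(* multiplicative structure of MathComp's ssralg hierarchy is unital.         *)
HB.mixin Record Zmodule_isRng R of GRing.Zmodule R := {
  rng_mul : R -> R -> R;
  rng_mulA : associative rng_mul;
  rng_mulDl : left_distributive rng_mul +%R;
  rng_mulDr : right_distributive rng_mul +%R
}.

#[short(type="rngType")]
HB.structure Definition Rng := {R of GRing.Zmodule R & Zmodule_isRng R}.

Declare Scope rng_scope.
Delimit Scope rng_scope with rng.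
Notation "x ** y" := (rng_mul x y)
  (at level 40, left associativity) : rng_scope.
Local Open Scope rng_scope.

Definition sumset (V : zmodType) (A B : {fset V}) : {fset V} :=
  [fset a + b | a in A, b in B].

Definition prodset (R : rngType) (A B : {fset R}) : {fset R} :=
  [fset a ** b | a in A, b in B].

(* The set of sums of n elements of A, not the set of multiples a *+ n. *)
Definition nsumset (V : zmodType) (n : nat) (A : {fset V}) : {fset V} :=
  iter n (sumset A) [fset 0].

Definition add_symmetric (V : zmodType) (A : {fset V}) : Prop :=
  0 \in A /\ A = [fset - a | a in A].

(* "At most K translates" is the same as "K translates, repetitions allowed"  *)
(* for the nonempty sets considered here.                                     *)
Definition covered_by (V : zmodType) (K : nat) (A B : {fset V}) : Prop :=
  exists F : {fset V}, (#|` F| <= K)%N /\ A `<=` sumset F B.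

Definition add_commensurable (V : zmodType) (K : nat) (A B : {fset V}) : Prop :=
  covered_by K A B /\ covered_by K B A.

Definition approximate_subring (R : rngType) (K : nat) (X : {fset R}) : Prop :=
  add_symmetric X /\ covered_by K (prodset X X `|` sumset X X) X.

Definition thick_subset (V : zmodType) (N : nat) (Y D : {fset V}) : Prop :=
  [/\ (0 < N)%N, add_symmetric Y, add_symmetric D, D `<=` Y &
      forall r : 'I_N -> V, (forall i, r i \in Y) ->
        exists i j : 'I_N, (i < j)%N /\ r i - r j \in D].

Definition zero_divisor (R : rngType) (d : R) : Prop :=
  exists x : R, x != 0 /\ (d ** x = 0 \/ x ** d = 0).

Definition is_subring (R : rngType) (Y : {fset R}) : Prop :=
  zmod_closed (mem Y) /\ {in Y &, forall x y, x ** y \in Y}.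

(* Main.v *)
(* If the zero divisors in Y do not form a thick set, then long sequences in  *)
(* Y exist whose differences lie outside that set. Pigeonhole yields such a   *)
(* difference d in X + X with d W contained in Y, where W = Y + Y + Y Y; the  *)
(* point is that this takes boundedly many elements, although W is not fixed  *)
(* in size. As d is not a zero divisor, |W| <= |Y|; hence W = Y and Y is a    *)
(* subring.                                                                   *)

(* Sizes are measured in translates of X. A set covered by n translates can be coloured with n + 1
   colours so that elements of equal colour differ by an element of X + X ([covered_by_coloring]).
   The uniform bound therefore reduces to covering W, 3X W, Y and Y W by a number of translates
   depending on K alone ([uniform_covering]), which holds because [tame] sets are stable under sums
   and products. [absorbing_difference] applies two such colourings to find d, and [nonsubring_card]
   gives the contradiction with |W| <= |Y|. *)
Require Import Defs.
From mathcomp Require Import all_boot all_order all_algebra.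
From mathcomp Require Import finmap.
From mathcomp Require boolp.

Set Implicit Arguments.
Unset Strict Implicit.
Unset Printing Implicit Defensive.

Import Order.TTheory GRing.Theory Num.Theory.

Local Open Scope fset_scope.
Local Open Scope ring_scope.
Local Open Scope rng_scope.

(** * Arithmetic in rings without unit *)

Section RngTheory.
Variable R : rngType.
Implicit Types x y z : R.

Lemma rng_mul0 x : x ** 0 = 0.
Proof. by apply: (addrI (x ** 0)); rewrite -rng_mulDr !addr0. Qed.

Lemma rng_0mul x : 0 ** x = 0.
Proof. by apply: (addrI (0 ** x)); rewrite -rng_mulDl !addr0. Qed.

Lemma rng_mulrN x y : x ** - y = - (x ** y).
Proof. by apply/eqP; rewrite -addr_eq0 -rng_mulDr addNr rng_mul0. Qed.

Lemma rng_mulNr x y : - x ** y = - (x ** y).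
Proof. by apply/eqP; rewrite -addr_eq0 -rng_mulDl addNr rng_0mul. Qed.

Lemma rng_mulBr x y z : x ** (y - z) = x ** y - x ** z.
Proof. by rewrite rng_mulDr rng_mulrN. Qed.

Lemma rng_mulBl x y z : (x - y) ** z = x ** z - y ** z.
Proof. by rewrite rng_mulDl rng_mulNr. Qed.

Lemma zero_divisorN x : zero_divisor x -> zero_divisor (- x).
Proof.
move=> [y [y0 xy]]; exists y; split=> //.
by rewrite rng_mulNr rng_mulrN; case: xy => ->; rewrite oppr0; [left|right].
Qed.

End RngTheory.

Lemma leq_imfset2_card (T1 T2 T : choiceType) (f : T1 -> T2 -> T)
    (A : {fset T1}) (B : {fset T2}) :
  (#|` [fset f a b | a in A, b in B]| <= #|` A| * #|` B|)%N.
Proof.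
by rewrite unlock size_seq_fset (leq_trans (size_undup _)) // size_allpairs.
Qed.

(** * Sumsets, coverings by translates, colourings and thick sets *)

Section Sumsets.
Variable V : zmodType.
Implicit Types A B C D F X Y : {fset V}.

Lemma sumsetP A B v :
  reflect (exists a b, [/\ a \in A, b \in B & v = a + b]) (v \in sumset A B).
Proof.
apply: (iffP (imfset2P _ _ _ _ _)) => [[a aA [b bB ->]]|[a [b [aA bB ->]]]].
  by exists a, b.
by exists a => //; exists b.
Qed.

Lemma mem_sumset A B a b : a \in A -> b \in B -> a + b \in sumset A B.
Proof. by move=> aA bB; apply/sumsetP; exists a, b. Qed.

Lemma sumsetA A B C : sumset A (sumset B C) = sumset (sumset A B) C.
Proof.
apply/fsetP=> v; apply/sumsetP/sumsetP.
  move=> [a [_ [aA /sumsetP[b [c [bB cC ->]]] ->]]]; exists (a + b), c.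
  by rewrite mem_sumset // addrA.
move=> [_ [c [/sumsetP[a [b [aA bB ->]]] cC ->]]]; exists a, (b + c).
by rewrite mem_sumset // addrA.
Qed.

Lemma subset_sumset A A' B B' :
  A `<=` A' -> B `<=` B' -> sumset A B `<=` sumset A' B'.
Proof.
move=> /fsubsetP sA /fsubsetP sB; apply/fsubsetP=> _ /sumsetP[a [b [aA bB ->]]].
by rewrite mem_sumset ?sA ?sB.
Qed.

Lemma sumset_subl A B : 0 \in B -> A `<=` sumset A B.
Proof. by move=> B0; apply/fsubsetP=> a aA; rewrite -[a]addr0 mem_sumset. Qed.

Lemma sumset_subr A B : 0 \in A -> B `<=` sumset A B.
Proof. by move=> A0; apply/fsubsetP=> a aA; rewrite -[a]add0r mem_sumset. Qed.

Lemma card_sumset A B : (#|` sumset A B| <= #|` A| * #|` B|)%N.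
Proof. exact: leq_imfset2_card. Qed.

Lemma nsumsetS n A : nsumset n.+1 A = sumset A (nsumset n A).
Proof. by []. Qed.

Lemma nsumset1 A : nsumset 1 A = A.
Proof.
apply/fsetP=> v; apply/sumsetP/idP => [[a [b [aA]]]|vA].
  by rewrite inE => /eqP-> ->; rewrite addr0.
by exists v, 0; rewrite inE addr0.
Qed.

Lemma nsumset2 A : nsumset 2 A = sumset A A.
Proof. by rewrite nsumsetS nsumset1. Qed.

Lemma nsumsetD m n A a b :
  a \in nsumset m A -> b \in nsumset n A -> a + b \in nsumset (m + n) A.
Proof.
elim: m a => [|m IH] a; first by rewrite inE => /eqP->; rewrite add0r.
move=> /sumsetP[a1 [a2 [a1A a2A ->]]] bA.
by rewrite addSn nsumsetS -addrA mem_sumset // IH.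
Qed.

Lemma mem0_nsumset n A : 0 \in A -> 0 \in nsumset n A.
Proof.
by move=> A0; elim: n => [|n IH]; rewrite ?inE // -[0]addr0 mem_sumset.
Qed.

Lemma nsumset_mono m n A : (m <= n)%N -> 0 \in A -> nsumset m A `<=` nsumset n A.
Proof.
move=> mn A0; apply/fsubsetP=> a aA.
by rewrite -(subnKC mn) -[a]addr0 nsumsetD // mem0_nsumset.
Qed.

Lemma add_symmetricP A :
  add_symmetric A <-> 0 \in A /\ forall a, a \in A -> - a \in A.
Proof.
split=> [[A0 AE]|[A0 AN]]; split=> //.
  by move=> a aA; rewrite AE; apply/imfsetP; exists a.
apply/fsetP=> a; apply/idP/imfsetP => /= [aA|[b bA ->]]; last exact: AN.
by exists (- a); rewrite ?opprK ?AN.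
Qed.

Lemma nsumsetN n A a :
  add_symmetric A -> a \in nsumset n A -> - a \in nsumset n A.
Proof.
move=> /add_symmetricP[A0 AN]; elim: n a => [|n IH] a.
  by rewrite !inE oppr_eq0.
by move=> /sumsetP[b [c [bA cA ->]]]; rewrite opprD mem_sumset ?AN ?IH.
Qed.

Lemma covered_by_sub n A B X :
  A `<=` B -> covered_by n B X -> covered_by n A X.
Proof. by move=> AB [F [cF BF]]; exists F; split=> //; apply: fsubset_trans BF. Qed.

Lemma covered_by_leq m n A X :
  (m <= n)%N -> covered_by m A X -> covered_by n A X.
Proof. by move=> mn [F [cF AF]]; exists F; split=> //; apply: leq_trans mn. Qed.

Lemma covered_by_card F X : 0 \in X -> covered_by #|` F| F X.
Proof. by move=> X0; exists F; split; rewrite ?sumset_subl. Qed.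

Lemma covered_by_supset A X : A `<=` X -> covered_by 1 A X.
Proof.
move=> AX; exists [fset 0]; rewrite cardfs1; split=> //.
by apply: fsubset_trans AX _; apply: sumset_subr; rewrite inE.
Qed.

Lemma covered_by_bigcup (I : choiceType) m n (J : {fset I})
    (B : I -> {fset V}) A X :
  (#|` J| <= m)%N -> (forall j, j \in J -> covered_by n (B j) X) ->
  (forall a, a \in A -> exists2 j, j \in J & a \in B j) ->
  covered_by (m * n) A X.
Proof.
move=> cJ cov AJ; apply: covered_by_leq (leq_mul cJ (leqnn n)) _.
elim/finSet_rect: J A {cJ} cov AJ => J IH A cov AJ.
have [J0|[j jJ]] := fset_0Vmem J.
  exists fset0; rewrite cardfs0; split=> //.
  by apply/fsubsetP=> a /AJ[j]; rewrite J0 inE.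
have ltJ : J `\ j `<` J by rewrite fproperD1.
have [F [cF /fsubsetP BF]] := cov j jJ.
have [|a|G [cG /fsubsetP AG]] := IH _ ltJ (A `\` B j).
- by move=> k; rewrite !inE => /andP[_]; apply: cov.
- rewrite inE => /andP[aBj /AJ[k kJ aBk]]; exists k => //.
  by rewrite !inE kJ andbT; apply: contraNneq aBj => <-.
exists (F `|` G); split.
  rewrite (leq_trans (leq_card_fsetU _ _)) // (cardfsD1 j J) jJ mulSn.
  exact: leq_add.
apply/fsubsetP=> a aA; have [aBj|aBj] := boolP (a \in B j).
  exact: (fsubsetP (subset_sumset (fsubsetUl _ _) (fsubset_refl _))) (BF _ aBj).
apply: (fsubsetP (subset_sumset (fsubsetUr _ _) (fsubset_refl _))).
by apply: AG; rewrite !inE aBj.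
Qed.

Lemma covered_by_sum K m n A B X : covered_by K (sumset X X) X ->
  covered_by m A X -> covered_by n B X ->
  covered_by (m * n * K) (sumset A B) X.
Proof.
move=> [E [cE /fsubsetP XE]] [F [cF /fsubsetP AF]] [G [cG /fsubsetP BG]].
exists (sumset (sumset F G) E); split.
  rewrite (leq_trans (card_sumset _ _)) // leq_mul //.
  by rewrite (leq_trans (card_sumset _ _)) // leq_mul.
apply/fsubsetP=> _ /sumsetP[a [b [/AF aA /BG bB ->]]].
move: aA bB => /sumsetP[f [x [fF xX ->]]] /sumsetP[g [y [gG yX ->]]].
have /sumsetP[e [z [eE zX xyE]]] := XE _ (mem_sumset xX yX).
by rewrite addrACA xyE addrA !mem_sumset.
Qed.

Lemma covered_by_nsumset K m n A X : covered_by K (sumset X X) X ->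
  covered_by m A X -> covered_by (m ^ n.+1 * K ^ n) (nsumset n.+1 A) X.
Proof.
move=> XK mA; elim: n => [|n IH]; first by rewrite nsumset1 muln1 expn1.
rewrite nsumsetS; apply: covered_by_leq (covered_by_sum XK mA IH).
by rewrite (expnS m n.+1) (expnSr K n) !mulnA.
Qed.

Lemma covered_by_pruned n A X : add_symmetric X -> covered_by n A X ->
  exists F, [/\ (#|` F| <= n)%N, A `<=` sumset F X & F `<=` sumset A X].
Proof.
move=> /add_symmetricP[_ XN] [F [cF /fsubsetP AF]].
exists (F `&` sumset A X); split; last exact: fsubsetIr.
  by apply: leq_trans cF; rewrite fsubset_leq_card // fsubsetIl.
apply/fsubsetP=> a aA; have /sumsetP[f [x [fF xX aE]]] := AF a aA.
rewrite aE mem_sumset // inE fF /=.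
by rewrite -(addrK x f) -aE mem_sumset ?XN.
Qed.

(** The colour of a is the index of the first translate containing it, and two elements of one
    translate differ by an element of X - X = X + X. The extra colour makes the colour type
    nonempty, so that [inord] applies. *)
Lemma covered_by_coloring n A X : add_symmetric X -> covered_by n A X ->
  exists c : V -> 'I_n.+1,
    {in A &, forall a b, c a = c b -> a - b \in sumset X X}.
Proof.
move=> /add_symmetricP[_ XN] [F [cF /fsubsetP AF]].
pose idx a := find (fun f => a - f \in X) F.
have idxP a : a \in A -> (idx a < size F)%N /\ a - nth 0 F (idx a) \in X.
  move=> /AF /sumsetP[f [x [fF xX ->]]].
  have h : has (fun g => f + x - g \in X) F.
    by apply/hasP; exists f => //; rewrite addrAC subrr add0r.
  by rewrite -has_find; split=> //; apply: (nth_find 0 h).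
exists (fun a => inord (idx a)) => a b /idxP[la aX] /idxP[lb bX] cab.
have lt i : (i < size F -> i < n.+1)%N by move=> /leq_trans; apply; apply: leqW.
have iab : idx a = idx b by rewrite -(inordK (lt _ la)) cab inordK ?lt.
rewrite iab in aX.
have -> : a - b = (a - nth 0 F (idx b)) - (b - nth 0 F (idx b)).
  by rewrite opprB addrA addrNK.
by rewrite mem_sumset ?XN.
Qed.

Lemma covered_by_family_coloring (I : finType) (phi : I -> V -> V) n A X :
  add_symmetric X -> (forall i, covered_by n [fset phi i a | a in A] X) ->
  exists c : V -> {ffun I -> 'I_n.+1},
    {in A &, forall a b, c a = c b ->
      forall i, phi i a - phi i b \in sumset X X}.
Proof.
move=> Xs /(_ _) cov.
have /fin_all_exists[c cP] i := covered_by_coloring Xs (cov i).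
exists (fun a => [ffun i => c i (phi i a)]) => a b aA bA /ffunP cab i.
apply: cP; first by apply/imfsetP; exists a.
  by apply/imfsetP; exists b.
by have := cab i; rewrite !ffunE.
Qed.

Lemma thick_subset_covering N Y D : thick_subset N Y D ->
  covered_by N.-1 Y D.
Proof.
move=> [N0 _ /add_symmetricP[D0 DN] _ Dthick].
(* A sequence in Y with no difference in D has length below N; if it is       *)
(* maximal, its D-translates cover Y.                                         *)
pose sep (s : seq V) := {subset s <= Y} /\ pairwise (fun a b => a - b \notin D) s.
have sep_size s : sep s -> (size s <= N.-1)%N.
  move=> [sY sD]; rewrite leqNgt; apply/negP; rewrite prednK // => Ns.
  have [|i [j [ij]]] := Dthick (fun i => nth 0 s i).
    by move=> i; apply/sY/mem_nth/(leq_trans (ltn_ord i)).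
  apply/negP; have /(pairwiseP 0) := sD; apply => //; rewrite inE;
    exact: leq_trans (ltn_ord _) Ns.
suff [s [[sY sD] Ycov]] : exists s, sep s /\
    forall y, y \in Y -> exists2 a, a \in s & a - y \in D.
  exists [fset a in s]; split.
    by rewrite (leq_trans _ (sep_size s _)) // card_fseq size_undup.
  apply/fsubsetP=> y /Ycov[a aS ayD].
  have -> : y = a + - (a - y) by rewrite opprB addrC addrNK.
  by rewrite mem_sumset ?DN // !inE.
apply: boolp.contrapT => no_maximal.
suff [s /sep_size + sN] : exists2 s, sep s & size s = N.
  by rewrite sN -ltnS prednK // ltnn.
elim: {sep_size} N {N0 Dthick} => [|n [s [sY sD] sn]].
  by exists [::] => //; split.
have /boolp.existsNP[y /boolp.not_implyP[yY yN]] :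
    ~ forall y, y \in Y -> exists2 a, a \in s & a - y \in D.
  by move=> cov; apply: no_maximal; exists s.
exists (rcons s y); last by rewrite size_rcons sn.
split; first by move=> z; rewrite mem_rcons inE => /orP[/eqP->|/sY].
rewrite pairwise_rcons sD andbT; apply/allP=> a aS.
by apply/negP=> ayD; apply: yN; exists a.
Qed.

End Sumsets.

(** * Product sets and tame sets *)

Section Products.
Variable R : rngType.
Implicit Types A B C F X Y : {fset R}.

Lemma prodsetP A B v :
  reflect (exists a b, [/\ a \in A, b \in B & v = a ** b]) (v \in prodset A B).
Proof.
apply: (iffP (imfset2P _ _ _ _ _)) => [[a aA [b bB ->]]|[a [b [aA bB ->]]]].
  by exists a, b.
by exists a => //; exists b.
Qed.

Lemma mem_prodset A B a b : a \in A -> b \in B -> a ** b \in prodset A B.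
Proof. by move=> aA bB; apply/prodsetP; exists a, b. Qed.

Lemma card_prodset A B : (#|` prodset A B| <= #|` A| * #|` B|)%N.
Proof. exact: leq_imfset2_card. Qed.

Lemma subset_prodset A A' B B' :
  A `<=` A' -> B `<=` B' -> prodset A B `<=` prodset A' B'.
Proof.
move=> /fsubsetP sA /fsubsetP sB; apply/fsubsetP=> _ /prodsetP[a [b [aA bB ->]]].
by rewrite mem_prodset ?sA ?sB.
Qed.

Lemma prodsetA A B C : prodset A (prodset B C) = prodset (prodset A B) C.
Proof.
apply/fsetP=> v; apply/prodsetP/prodsetP.
  move=> [a [_ [aA /prodsetP[b [c [bB cC ->]]] ->]]]; exists (a ** b), c.
  by rewrite mem_prodset // rng_mulA.
move=> [_ [c [/prodsetP[a [b [aA bB ->]]] cC ->]]]; exists a, (b ** c).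
by rewrite mem_prodset // rng_mulA.
Qed.

Lemma prodset1 (a b : R) : prodset [fset a] [fset b] = [fset a ** b].
Proof.
apply/fsetP=> v; rewrite inE; apply/prodsetP/eqP => [[a' [b' []]]|->].
  by rewrite !inE => /eqP-> /eqP->.
by exists a, b; rewrite !inE.
Qed.

Lemma prodset_suml A B C :
  prodset (sumset A B) C `<=` sumset (prodset A C) (prodset B C).
Proof.
apply/fsubsetP=> _ /prodsetP[_ [c [/sumsetP[a [b [aA bB ->]]] cC ->]]].
by rewrite rng_mulDl mem_sumset ?mem_prodset.
Qed.

Lemma prodset_sumr A B C :
  prodset A (sumset B C) `<=` sumset (prodset A B) (prodset A C).
Proof.
apply/fsubsetP=> _ /prodsetP[a [_ [aA /sumsetP[b [c [bB cC ->]]] ->]]].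
by rewrite rng_mulDr mem_sumset ?mem_prodset.
Qed.

Lemma prodset_nsumset n A B : prodset A (nsumset n B) `<=` nsumset n (prodset A B).
Proof.
apply/fsubsetP=> _ /prodsetP[a [b [aA bB ->]]].
elim: n b bB => [|n IH] b; first by rewrite inE => /eqP->; rewrite rng_mul0 inE.
move=> /sumsetP[b1 [b2 [b1B b2B ->]]].
by rewrite rng_mulDr nsumsetS mem_sumset ?mem_prodset ?IH.
Qed.

Lemma covered_by_prodl m n F B X : (#|` F| <= m)%N ->
  (forall f, f \in F -> covered_by n (prodset [fset f] B) X) ->
  covered_by (m * n) (prodset F B) X.
Proof.
move=> cF cov; apply: covered_by_bigcup cF cov _.
move=> _ /prodsetP[a [b [aF bB ->]]]; exists a => //.
by rewrite mem_prodset ?inE.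
Qed.

Lemma covered_by_prodr m n F B X : (#|` F| <= m)%N ->
  (forall f, f \in F -> covered_by n (prodset B [fset f]) X) ->
  covered_by (m * n) (prodset B F) X.
Proof.
move=> cF cov; apply: covered_by_bigcup cF cov _.
move=> _ /prodsetP[b [a [bB aF ->]]]; exists a => //.
by rewrite mem_prodset ?inE.
Qed.

(* Being covered by few translates of X is not visibly stable under products, *)
(* as the translating elements are arbitrary; adding that every a in A almost *)
(* preserves X on both sides makes it so.                                     *)
Definition tame X n A :=
  covered_by n A X /\
  forall a, a \in A -> covered_by n (prodset [fset a] X) X
                   /\ covered_by n (prodset X [fset a]) X.

Lemma tame_leq m n A X : (m <= n)%N -> tame X m A -> tame X n A.
Proof.
move=> mn [cA eA]; split=> [|a /eA[]]; first exact: covered_by_leq cA.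
by move=> /(covered_by_leq mn) ? /(covered_by_leq mn).
Qed.

Lemma tame_sub n A B X : A `<=` B -> tame X n B -> tame X n A.
Proof.
move=> AB [cB eB]; split=> [|a /(fsubsetP AB)/eB//].
exact: covered_by_sub cB.
Qed.

(** * Stability of tameness, and the set Y *)

Section ApproximateSubring.
Variables (K : nat) (X : {fset R}).
Hypothesis XK : approximate_subring K X.

Let Xsym : add_symmetric X. Proof. by case: XK. Qed.
Let X0 : 0 \in X. Proof. by case: Xsym. Qed.

Lemma approximate_subring_sum : covered_by K (sumset X X) X.
Proof. by case: XK => _; apply: covered_by_sub; apply: fsubsetUr. Qed.

Lemma approximate_subring_prod : covered_by K (prodset X X) X.
Proof. by case: XK => _; apply: covered_by_sub; apply: fsubsetUl. Qed.

Let XX := approximate_subring_sum.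

Lemma approximate_subring_gt0 : (0 < K)%N.
Proof.
have [F [cF /fsubsetP/(_ _ (mem_sumset X0 X0)) /sumsetP[f [_ [fF _ _]]]]] := XX.
by apply: leq_trans cF; rewrite cardfs_gt0; apply/fset0Pn; exists f.
Qed.
Let K0 := approximate_subring_gt0.

Lemma tame0 : tame X 1 [fset 0].
Proof.
split; first by apply: covered_by_supset; rewrite fsub1set.
move=> a; rewrite inE => /eqP->; split; apply: covered_by_supset.
  apply/fsubsetP=> v /prodsetP[a' [b []]].
  by rewrite inE => /eqP-> _ ->; rewrite rng_0mul.
apply/fsubsetP=> v /prodsetP[b [a' []]] _.
by rewrite inE => /eqP-> ->; rewrite rng_mul0.
Qed.

Lemma tame_approximate_subring : tame X K X.
Proof.
split=> [|x xX]; first exact: covered_by_leq K0 (covered_by_supset _).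
by split; apply: covered_by_sub approximate_subring_prod;
  rewrite subset_prodset ?fsub1set.
Qed.

Lemma tame_sum m n A B :
  tame X m A -> tame X n B -> tame X (m * n * K) (sumset A B).
Proof.
move=> [cA eA] [cB eB]; split; first exact: covered_by_sum.
move=> v /sumsetP[a [b [aA bB ->]]].
have [aX Xa] := eA a aA; have [bX Xb] := eB b bB.
have sub : [fset a + b] `<=` sumset [fset a] [fset b].
  by rewrite fsub1set mem_sumset ?inE.
split.
  apply: covered_by_sub (covered_by_sum XX aX bX).
  exact: fsubset_trans (subset_prodset sub (fsubset_refl X)) (prodset_suml _ _ _).
apply: covered_by_sub (covered_by_sum XX Xa Xb).
exact: fsubset_trans (subset_prodset (fsubset_refl X) sub) (prodset_sumr _ _ _).
Qed.

Lemma tame_nsumset n k A :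
  tame X n A -> tame X ((n * K) ^ k) (nsumset k A).
Proof.
move=> tA; elim: k => [|k IH]; first exact: tame0.
rewrite nsumsetS expnS; apply: tame_leq (tame_sum tA IH).
by rewrite mulnAC.
Qed.

(** If B is contained in G + X, then a B is contained in a G + a X, and a X is covered by
    hypothesis. *)
Lemma covered_by_mul1l m n a B :
  covered_by m (prodset [fset a] X) X -> covered_by n B X ->
  covered_by (n * m) (prodset [fset a] B) X.
Proof.
move=> [F [cF aX]] [G [cG BG]]; exists (sumset (prodset [fset a] G) F); split.
  rewrite (leq_trans (card_sumset _ _)) // leq_mul //.
  by rewrite (leq_trans (card_prodset _ _)) // cardfs1 mul1n.
rewrite -sumsetA; apply: fsubset_trans (subset_sumset (fsubset_refl _) aX).
by apply: fsubset_trans (prodset_sumr _ _ _); rewrite subset_prodset.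
Qed.

Lemma covered_by_mul1r m n a B :
  covered_by m (prodset X [fset a]) X -> covered_by n B X ->
  covered_by (n * m) (prodset B [fset a]) X.
Proof.
move=> [F [cF aX]] [G [cG BG]]; exists (sumset (prodset G [fset a]) F); split.
  rewrite (leq_trans (card_sumset _ _)) // leq_mul //.
  by rewrite (leq_trans (card_prodset _ _)) // cardfs1 muln1.
rewrite -sumsetA; apply: fsubset_trans (subset_sumset (fsubset_refl _) aX).
by apply: fsubset_trans (prodset_suml _ _ _); rewrite subset_prodset.
Qed.

(** The first summand bounds the covering of A B itself through FG + FX + XG + XX, one factor for
    each piece and a K for each addition; the second bounds a b X and X a b. *)
Definition tame_prod_bound m n :=
  ((m * n) * (m * (m * K * K)) * K * ((n * (n * K * K)) * K * K) * K + m * n)%N.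

(** With pruned translating sets, A B lies in (F + X)(G + X). Here FG has at most m n elements,
    while F and G lie in the tame sets A + X and B + X, so that each f X and each X g is covered by
    few translates of X. *)
Lemma tame_prod m n A B :
  tame X m A -> tame X n B -> tame X (tame_prod_bound m n) (prodset A B).
Proof.
move=> tA tB; have [[cA eA] [cB eB]] := (tA, tB); split; last first.
  move=> v /prodsetP[a [b [aA bB ->]]].
  have [aX Xa] := eA a aA; have [bX Xb] := eB b bB.
  rewrite -prodset1; split.
    rewrite -prodsetA; apply: covered_by_leq (covered_by_mul1l aX bX).
    by rewrite [leqLHS]mulnC; apply: leq_addl.
  rewrite prodsetA; apply: covered_by_leq (covered_by_mul1r Xb Xa).
  by rewrite leq_addl.
have [F [cF AF FA]] := covered_by_pruned Xsym cA.
have [G [cG BG GB]] := covered_by_pruned Xsym cB.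
have [_ eF] := tame_sub FA (tame_sum tA tame_approximate_subring).
have [_ eG] := tame_sub GB (tame_sum tB tame_approximate_subring).
apply: covered_by_leq (leq_addr _ _) _.
apply: (@covered_by_sub _ _ _ (sumset (sumset (prodset F G) (prodset F X))
                                      (sumset (prodset X G) (prodset X X)))).
  apply: fsubset_trans (subset_prodset AF BG) _.
  apply: fsubset_trans (prodset_suml _ _ _) _.
  by rewrite subset_sumset ?prodset_sumr.
have cFG : covered_by (m * n) (prodset F G) X.
  apply: covered_by_leq (covered_by_card _ X0).
  by rewrite (leq_trans (card_prodset _ _)) // leq_mul.
have cFX := covered_by_prodl cF (fun f fF => (eF f fF).1).
have cXG := covered_by_prodr cG (fun g gG => (eG g gG).2).
apply: (covered_by_sum XX); first exact: (covered_by_sum XX cFG cFX).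
exact: (covered_by_sum XX cXG approximate_subring_prod).
Qed.

(** The set Y of the theorem. Its shape leaves room for d w: two terms from X + X add up in 4X, and
    a product from X (X + X) fits into X 4X. *)
Definition ideal_hull := sumset (nsumset 4 X) (prodset X (nsumset 4 X)).
Let Y := ideal_hull.

Lemma mem0_ideal_hull : 0 \in Y.
Proof.
rewrite -[0]addr0 mem_sumset ?mem0_nsumset //.
by rewrite -[0](rng_mul0 0) mem_prodset ?mem0_nsumset.
Qed.

Lemma ideal_hullN a : a \in Y -> - a \in Y.
Proof.
move=> /sumsetP[b [_ [bX /prodsetP[x [c [xX cX ->]]] ->]]].
by rewrite opprD -rng_mulrN mem_sumset ?mem_prodset ?nsumsetN.
Qed.

Lemma nsumset4_sub_ideal_hull : nsumset 4 X `<=` Y.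
Proof.
by apply: sumset_subl; rewrite -[0](rng_mul0 0) mem_prodset ?mem0_nsumset.
Qed.

Lemma ideal_hull_commensurable : add_commensurable (K ^ 11)%N Y X.
Proof.
split; last first.
  apply: (@covered_by_leq _ 1); first by rewrite expn_gt0 K0.
  apply: covered_by_supset; apply: fsubset_trans nsumset4_sub_ideal_hull.
  by rewrite -{1}[X]nsumset1 nsumset_mono.
(* 4X costs K^3 translates; X 4X, inside 4(X X), costs K^4 K^3; adding the two costs one more K,
   whence the exponent 11. *)
have X4 := covered_by_nsumset 3 XX (covered_by_supset (fsubset_refl X)).
have P4 := covered_by_nsumset 3 XX approximate_subring_prod.
have := covered_by_sum XX X4 (covered_by_sub (prodset_nsumset _ _ _) P4).
by rewrite exp1n mul1n -!expnD -expnSr.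
Qed.

End ApproximateSubring.

(** * The enlargement W of Y, which exceeds Y unless Y is a subring *)

Definition ring_closure_step Y := sumset (sumset Y Y) (prodset Y Y).

Lemma sumset_sub_ring_closure_step Y :
  0 \in Y -> sumset Y Y `<=` ring_closure_step Y.
Proof. by move=> Y0; apply: sumset_subl; rewrite -[0](rng_mul0 0) mem_prodset. Qed.

Lemma prodset_sub_ring_closure_step Y :
  0 \in Y -> prodset Y Y `<=` ring_closure_step Y.
Proof. by move=> Y0; apply: sumset_subr; rewrite -[0]addr0 mem_sumset. Qed.

(** Since 0 is in Y, W contains Y, Y + Y and Y Y. By finiteness |W| <= |Y| forces W = Y, which makes
    Y closed under sums and products. *)
Lemma nonsubring_card Y : 0 \in Y -> (forall a, a \in Y -> - a \in Y) ->
  ~ is_subring Y -> (#|` Y| < #|` ring_closure_step Y|)%N.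
Proof.
move=> Y0 YN Ynr; rewrite ltnNge; apply/negP=> cW; apply: Ynr.
have YW : Y `<=` ring_closure_step Y.
  exact: fsubset_trans (sumset_subl _ Y0) (sumset_sub_ring_closure_step Y0).
have WY : ring_closure_step Y = Y.
  by apply/eqP; rewrite eq_sym eqEfcard YW.
split; last first.
  move=> a b aY bY; rewrite -WY.
  by apply: (fsubsetP (prodset_sub_ring_closure_step Y0)); apply: mem_prodset.
split=> // a b aY bY; rewrite -[_ \in _]/(_ \in Y) -WY.
apply: (fsubsetP (sumset_sub_ring_closure_step Y0)).
by apply: mem_sumset => //; apply: YN.
Qed.

End Products.

(** * Bounds depending on K alone, and the pigeonhole argument *)

Lemma uniform_covering K : exists n, forall (R : rngType) (X : {fset R}),
  approximate_subring K X ->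
  let Y := ideal_hull X in let W := ring_closure_step Y in
  [/\ covered_by n W X, covered_by n (prodset (nsumset 3 X) W) X,
      covered_by n Y X & covered_by n (prodset Y W) X].
Proof.
have summands_leq a b c d : [/\ a <= a + b + c + d, b <= a + b + c + d,
    c <= a + b + c + d & d <= a + b + c + d]%N.
  by split; rewrite ?leq_addl // -!addnA ?leq_addr // addnCA ?leq_addr //
    addnCA addnA addnCA leq_addr.
(* [s k], [y] and [w] are the tameness bounds of kX, Y and W. The witness adds up the four covering
   numbers merely to dominate each of them. *)
pose P := tame_prod_bound; pose s k := ((K * K) ^ k)%N.
pose y := (s 4 * P K K (s 4) * K)%N; pose w := ((y * y * K) * P K y y * K)%N.
exists (w + P K (s 3) w + y + P K y w)%N => R X XK Y W.
have tX := tame_approximate_subring XK.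
have ts k : tame X (s k) (nsumset k X) by apply: tame_nsumset.
have tY : tame X y Y.
  by apply: (tame_sum XK) (ts 4%N) _; apply: (tame_prod XK).
have tW : tame X w W.
  by apply: (tame_sum XK); [apply: (tame_sum XK)|apply: (tame_prod XK)].
have [[cW _] [cY _]] := (tW, tY).
have [c3W _] := tame_prod XK (ts 3%N) tW.
have [cYW _] := tame_prod XK tY tW.
have [le1 le2 le3 le4] := summands_leq w (P K (s 3%N) w) y (P K y w).
by split; [move: cW|move: c3W|move: cY|move: cYW]; apply: covered_by_leq.
Qed.

(* With X + X contained in T + X, write d = r_i - r_j = t + x. Cover W by     *)
(* classes f + s, where s and all T ** s lie in X + X; the number of classes  *)
(* depends only on K, so by pigeonhole some d sends all f into X + X. Then    *)
(* d ** (f + s) = (d ** f + t ** s) + x ** s.                                 *)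
Lemma absorbing_difference K : exists N, (0 < N)%N /\
  forall (R : rngType) (X : {fset R}), approximate_subring K X ->
  forall r : 'I_N -> R, (forall i, r i \in ideal_hull X) ->
  exists i j : 'I_N, [/\ (i < j)%N, r i - r j \in ideal_hull X &
    forall w, w \in ring_closure_step (ideal_hull X) ->
      (r i - r j) ** w \in ideal_hull X].
Proof.
have [n cov] := uniform_covering K.
(* [C] colours W: [None] records the class of w, [Some k] that of t_k w. The length is one more than
   the number of colours used for Y, so both counts are fixed before R and X. *)
pose C := {ffun option 'I_K -> 'I_n.+1}.
exists #|{ffun option C -> 'I_n.+1}|.+1; split=> // R X XK r rY.
have [cW c3W cY cYW] := cov R X XK.
set Y := ideal_hull X in rY cW c3W cY cYW *.
set W := ring_closure_step Y in cW c3W cYW *.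
have [Xsym _] := XK; have /add_symmetricP[X0 XN] := Xsym.
have Y0 : 0 \in Y := mem0_ideal_hull XK.
have W0 : 0 \in W.
  apply: (fsubsetP (sumset_sub_ring_closure_step Y0)).
  by rewrite -[0]addr0 mem_sumset.
(* Pruning puts T inside 3X, so the covering of 3X W applies to every t w. Indices past the end of T
   give the default 0, also in 3X. *)
have [T [cT XT T3]] := covered_by_pruned Xsym (approximate_subring_sum XK).
pose t (k : 'I_K) := nth 0 T k.
have t3 k : t k \in nsumset 3 X.
  have [lt|ge] := ltnP k (size T); last by rewrite /t nth_default ?mem0_nsumset.
  have /(fsubsetP T3)/sumsetP[a [b [aX bX tk]]] := mem_nth 0 lt.
  by rewrite /t tk (nsumsetD (m := 2) (n := 1)) ?nsumset2 ?nsumset1.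
have [kappa kappaP] : exists kappa : R -> C, {in W &, forall v w,
    kappa v = kappa w -> v - w \in sumset X X /\
    forall k, t k ** (v - w) \in sumset X X}.
  have [|c cP] := @covered_by_family_coloring _ (option 'I_K)
    (fun k w => if k is Some k then t k ** w else w) n W X Xsym.
    move=> [k|]; [apply: covered_by_sub c3W|apply: covered_by_sub cW];
      apply/fsubsetP=> _ /imfsetP[w /= wW ->] //.
    exact: mem_prodset.
  exists c => v w vW wW cvw; have := cP v w vW wW cvw => vw.
  by split=> [|k]; [exact: (vw None)|rewrite rng_mulBr; exact: (vw (Some k))].
(* One representative f per colour class of W; a colour that does not occur gets 0. *)
have /fin_all_exists[rep repP] (c : C) :
    exists f, f \in W /\ forall w, w \in W -> kappa w = c -> kappa f = c.
  have [[f [fW fc]]|no] := boolp.pselect (exists f, f \in W /\ kappa f = c).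
    by exists f.
  by exists 0; split=> // w wW wc; case: no; exists w.
(* The second colouring compares elements a of Y by the classes of a and of all a f; the covering of
   Y W bounds its colours. *)
have [lambda lambdaP] : exists lambda : R -> {ffun option C -> 'I_n.+1},
    {in Y &, forall a b, lambda a = lambda b -> a - b \in sumset X X /\
    forall c, (a - b) ** rep c \in sumset X X}.
  have [|c cP] := @covered_by_family_coloring _ (option C)
    (fun c a => if c is Some c then a ** rep c else a) n Y X Xsym.
    move=> [c|]; [apply: covered_by_sub cYW|apply: covered_by_sub cY];
      apply/fsubsetP=> _ /imfsetP[a /= aY ->] //.
    by apply: mem_prodset => //; case: (repP c).
  exists c => a b aY bY cab; have := cP a b aY bY cab => ab.
  by split=> [|k]; [exact: (ab None)|rewrite rng_mulBl; exact: (ab (Some k))].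
have [i [j [ij lij]]] : exists i j : 'I_#|{ffun option C -> 'I_n.+1}|.+1,
    (i < j)%N /\ lambda (r i) = lambda (r j).
  have /injectivePn[i [j ij lij]] : ~~ injectiveb (fun i => lambda (r i)).
    apply/negP=> /injectiveP /leq_card.
    by rewrite card_ord ltnn.
  have [lt|gt|eq] := ltngtP i j; [by exists i, j|by exists j, i|].
  by rewrite (val_inj eq) eqxx in ij.
have [d2 df] := lambdaP _ _ (rY i) (rY j) lij.
exists i, j; split=> //.
  apply: (fsubsetP (nsumset4_sub_ideal_hull XK)).
  by apply: (fsubsetP (nsumset_mono (isT : 2 <= 4)%N X0)); rewrite nsumset2.
move=> w wW; have [fW /(_ w wW erefl) wf] := repP (kappa w).
have [s2 ts] := kappaP _ _ wW fW (esym wf).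
set f := rep _ in fW wf s2 ts; set d := r i - r j in d2 df *.
have [u [x [uT xX dE]]] := sumsetP _ _ _ (fsubsetP XT _ d2).
have lt : (index u T < K)%N by rewrite (leq_trans _ cT) // index_mem.
have {}ts := ts (Ordinal lt); rewrite /t /= nth_index // in ts.
have -> : d ** w = (d ** f + u ** (w - f)) + x ** (w - f).
  by rewrite -addrA -rng_mulDl -dE -rng_mulDr addrC addrNK.
rewrite mem_sumset //.
  by rewrite (nsumsetD (m := 2) (n := 2)) ?nsumset2 //; apply: df.
rewrite mem_prodset //.
by apply: (fsubsetP (nsumset_mono (isT : 2 <= 4)%N X0)); rewrite nsumset2.
Qed.

(** * The cardinality bound and the dichotomy *)

Lemma thick_subset_card (V : zmodType) N (Y D : {fset V}) : thick_subset N Y D ->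
  #|` Y|%:R / (N%:R - 1) <= #|` D|%:R :> rat.
Proof.
move=> YD; have [F [cF YF]] := thick_subset_covering YD.
(* For N = 1 the denominator vanishes and the quotient is 0 by convention. *)
case: N YD cF => [[]//|[|N]] YD cF; first by rewrite subrr invr0 mulr0 ler0n.
rewrite -natr1 addrK ler_pdivrMr ?ltr0n // -natrM ler_nat.
rewrite (leq_trans (fsubset_leq_card YF)) // (leq_trans (card_sumset _ _)) //.
by rewrite mulnC leq_mul.
Qed.

Theorem theorem1p10 :
  forall K : nat, exists N : nat,
  forall (R : rngType) (X : {fset R}), approximate_subring K X ->
  let Y := sumset (nsumset 4 X) (prodset X (nsumset 4 X)) in
  (exists D : {fset R},
     [/\ thick_subset N Y D,
         (#|` Y|%:R / (N%:R - 1) <= #|` D|%:R :> rat) &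
         forall d : R, d \in D -> zero_divisor d])
  \/ (is_subring Y /\ add_commensurable (K ^ 11)%N Y X).
Proof.
move=> K; have [N [N0 absorb]] := absorbing_difference K.
exists N => R X XK Y.
have Y0 : 0 \in Y := mem0_ideal_hull XK.
have YN a : a \in Y -> - a \in Y by apply: (ideal_hullN XK).
have [Yr|Ynr] := boolp.pselect (is_subring Y); [right|left].
  by split=> //; apply: ideal_hull_commensurable.
pose D := [fset d in Y | boolp.asbool (zero_divisor d)].
have DP d : d \in D <-> d \in Y /\ zero_divisor d.
  rewrite !inE /=; split=> [/andP[-> /boolp.asboolP]//|[-> zd]].
  exact/boolp.asboolP.
have ltYW := nonsubring_card Y0 YN Ynr.
(* Otherwise R would be the zero ring, and Y would be a subring. *)
have zd0 : zero_divisor (0 : R).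
  apply: boolp.contrapT => nz0; have R0 (x : R) : x = 0.
    apply/eqP/negP => /negP x0; apply: nz0; exists x; split=> //.
    by left; rewrite rng_0mul.
  by apply: Ynr; split; [split=> // a b _ _|move=> a b _ _]; rewrite [X in X \in _]R0.
have Dthick : thick_subset N Y D.
  split=> //.
  - exact/add_symmetricP.
  - apply/add_symmetricP; split=> [|a /DP[aY za]]; apply/DP; split=> //.
      exact: YN.
    exact: zero_divisorN.
  - by apply/fsubsetP=> d /DP[].
  - move=> r /(absorb R X XK r)[i [j [ij dY dW]]]; exists i, j; split=> //.
    apply/DP; split=> //; apply: boolp.contrapT => nzd.
    (* Left multiplication by a d that is no zero divisor embeds W into Y, against |Y| < |W|. *)
    have inj : injective (rng_mul (r i - r j)).
      move=> a b ab; apply/eqP; rewrite -subr_eq0; apply/negP => /negP ab0.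
      apply: nzd; exists (a - b); split=> //; left.
      by rewrite rng_mulBr ab subrr.
    move: ltYW; rewrite ltnNge => /negP; apply.
    have sub : [fset (r i - r j) ** w | w in ring_closure_step Y] `<=` Y.
      by apply/fsubsetP=> _ /imfsetP[w /= wW ->]; apply: dW.
    by have := fsubset_leq_card sub; rewrite card_imfset.
exists D; split=> //; first exact: thick_subset_card.
by move=> d /DP[].
Qed.
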